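(* Let $G$ be a graph and let $x,y\in V(G)$ be distinct vertices such that $N[x]\cup N[y]=V(G)$ and $d(x)\ge d(y)$. If $d(x)\ge 4$ or $N(x)\cap N[y]\ne\emptyset$, then $G$ admits an antimagic orientation.
   Context: All graphs are finite and simple; $N(v)$ denotes the set of neighbours of $v$, $N[v]=N(v)\cup\{v\}$, and $d(v)$ the degree of $v$. For a digraph $D$ and an injective map $\tau$ from the arc set $A(D)$ to positive integers, $s_{(D,\tau)}(u)$ is the sum of labels of arcs entering $u$ minus the sum of labels of arcs leaving $u$ ($0$ if $u$ is isolated). If $D$ has $m$ arcs, a bijection $\tau:A(D)\to\{1,\dots,m\}$ is an antimagic labeling if the values $s_{(D,\tau)}(u)$ are pairwise distinct over all vertices. $G$ admits an antimagic orientation if some orientation $D$ of $G$ has an antimagic labeling. *)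

(* Defs.v *)
From HB Require Import structures.
From mathcomp Require Import all_boot all_order all_algebra.
Set Implicit Arguments. Unset Strict Implicit. Unset Printing Implicit Defensive.
Import GRing.Theory Num.Theory.

Definition simple_graph (T : finType) (e : rel T) : Prop :=
  symmetric e /\ irreflexive e.

Definition nbhd (T : finType) (e : rel T) (v : T) : {set T} := [set w | e v w].
Definition cnbhd (T : finType) (e : rel T) (v : T) : {set T} := v |: nbhd e v.
Definition deg (T : finType) (e : rel T) (v : T) : nat := #|nbhd e v|.

Definition is_orientation (T : finType) (e : rel T) (o : rel T) : Prop :=
  (forall u v, o u v -> e u v) /\ (forall u v, e u v -> o u v (+) o v u).

Definition arcs (T : finType) (o : rel T) : {set T * T} :=
  [set p | o p.1 p.2].

(* tau restricted to the arcs is a bijection onto {1,...,m}, m = #arcs *)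
Definition antimagic_labeling_map (T : finType) (o : rel T) (tau : T * T -> nat)
  : Prop :=
  {in arcs o &, injective tau} /\
  (forall p, p \in arcs o -> 1 <= tau p <= #|arcs o|)%N.

Definition vsum (T : finType) (o : rel T) (tau : T * T -> nat) (u : T) : int :=
  (\sum_(v | o v u) (tau (v, u))%:Z - \sum_(v | o u v) (tau (u, v))%:Z)%R.

Definition has_antimagic_orientation (T : finType) (e : rel T) : Prop :=
  exists (o : rel T) (tau : T * T -> nat),
    [/\ is_orientation e o, antimagic_labeling_map o tau & injective (vsum o tau)].

(* Main.v *)
From HB Require Import structures.
Require Import Defs.
From mathcomp Require Import all_boot all_order all_algebra.
From mathcomp Require Import zify.
Set Implicit Arguments. Unset Strict Implicit. Unset Printing Implicit Defensive.
Import Order.TTheory GRing.Theory Num.Theory.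

(** Every vertex [v] other than the hubs [x], [y] is adjacent to a hub, and
    receives an arc from one of them carrying one of the largest labels.  The
    [m] edges avoiding the hubs are oriented and labelled [m], ..., [1] in such
    an order that an arc only leaves a vertex still holding a token, every
    vertex starting with one token and every arc carrying its token to its head;
    then no partial sum is below [-m].  Such an order exists: fusing two edges
    that share a vertex reduces to fewer edges.  Handing out the top labels in the
    order of the partial sums makes the sums of the non-hubs distinct and
    positive, while those of the hubs are nonpositive, so only a coincidence of
    the two hubs remains to be avoided.  If they have a common neighbour, one
    exchanges the labels of its two hub edges; if they are adjacent, one reverses
    their edge; otherwise one shifts a block of top labels across a boundary
    between the two neighbourhoods.  That shift is possible unless the partial
    sums take exactly two consecutive values, which is excluded since their total
    is zero. *)

(** * Edge lists and the token game *)

Definition edge_count (T : finType) (a b : T) (s : seq (T * T)) : nat :=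
  count (fun q => (q == (a, b)) || (q == (b, a))) s.
Arguments edge_count : simpl never.

(** Tokens on vertices: [t v] is the stock of [v], and each arc in turn moves one token from its
    tail to its head. The test on [t q.1] keeps the truncated subtraction exact. *)
Fixpoint playable (T : finType) (t : T -> nat) (s : seq (T * T)) : bool :=
  if s is q :: s' then
    (0 < t q.1) && playable (fun v => t v - (v == q.1) + (v == q.2)) s'
  else true.

Lemma playable_mono (T : finType) (s : seq (T * T)) (t t' : T -> nat) :
  (forall q, q \in s -> t q.1 <= t' q.1) ->
  playable t s -> playable t' s.
Proof.
elim: s t t' => [//|q s IH] t t' le_tt' /= /andP[t_gt0 pl_s].
have le_q := le_tt' q (mem_head _ _); apply/andP; split; first exact: leq_trans le_q.
apply: IH pl_s => r rs; have := le_tt' r; rewrite inE rs orbT => /(_ isT) /= le_r.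
by rewrite leq_add2r leq_sub2r.
Qed.

(** The token that [v] receives from [a] is the one it passes on to [b], so afterwards no vertex
    holds less than after the direct move. *)
Lemma playable_subdivide (T : finType) (a v b : T) (s1 s2 : seq (T * T)) t :
  playable t (s1 ++ (a, b) :: s2) -> playable t (s1 ++ (a, v) :: (v, b) :: s2).
Proof.
elim: s1 t => [|q s1 IH] t /=; last by case/andP=> -> /IH.
case/andP=> ta pl; rewrite ta eqxx /=; apply/andP; split; first by lia.
by apply: playable_mono pl => q _; have [->|] := eqVneq q.1 a; lia.
Qed.

Lemma edge_count_cat (T : finType) (a b : T) s1 s2 :
  edge_count a b (s1 ++ s2) = edge_count a b s1 + edge_count a b s2.
Proof. exact: count_cat. Qed.

Lemma edge_count_cons (T : finType) (a b : T) q s :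
  edge_count a b (q :: s) = edge_count a b [:: q] + edge_count a b s.
Proof. by rewrite -cat1s edge_count_cat. Qed.

Lemma edge_count_flip (T : finType) (a b c d : T) :
  edge_count a b [:: (c, d)] = edge_count a b [:: (d, c)].
Proof. by rewrite /edge_count /= !xpair_eqE; do ?case: eqP. Qed.

Lemma edge_count_gt0 (T : finType) (a b : T) s :
  (0 < edge_count a b s) = ((a, b) \in s) || ((b, a) \in s).
Proof.
rewrite -has_count; apply/hasP/orP => [[q qs /orP[]/eqP<-]|]; [by left|by right|].
by case=> qs; [exists (a, b)|exists (b, a)]; rewrite ?eqxx ?orbT.
Qed.

(** Lists rather than simple graphs, since fusing edges may create loops and parallel edges. The
    fused edge is split again at its place in the order found by induction. *)
Lemma exists_playable (T : finType) (l : seq (T * T)) :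
  exists2 s, forall a b, edge_count a b s = edge_count a b l
    & playable (fun=> 1) s.
Proof.
have [n] := ubnP (size l); elim: n l => // n IH [_|[q1 q2] l /= ltn].
  by exists [::].
pose touch (q : T * T) := has (fun v => (v == q1) || (v == q2)) [:: q.1; q.2].
have [/hasP[[r1 r2] rl touch_r]|/hasPn no_touch] := boolP (has touch l).
  have El := perm_to_rem rl; set l' := rem _ l in El.
  have szl : size l = (size l').+1 by rewrite (perm_size El).
  have cntl a b : edge_count a b l
      = edge_count a b [:: (r1, r2)] + edge_count a b l'.
    by rewrite -edge_count_cons; apply/permP.
  (* With [v] the shared end, the two edges are [cv] and [vd] up to direction; they fuse into
     [cd]. *)
  have [c [v [d [cnt1 cnt2]]]] : exists c v d,
      (forall a b, edge_count a b [:: (q1, q2)] = edge_count a b [:: (c, v)]) /\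
      (forall a b, edge_count a b [:: (r1, r2)] = edge_count a b [:: (v, d)]).
    move: touch_r; rewrite /touch /= orbF.
    case/orP=> /orP[]/eqP->.
    - by exists q2, q1, r2; split=> a b //; rewrite edge_count_flip.
    - by exists q1, q2, r2.
    - by exists q2, q1, r1; split=> a b; rewrite edge_count_flip.
    - by exists q1, q2, r1; split=> a b //; rewrite edge_count_flip.
  have [|s cnt_s pl_s] := IH ((c, d) :: l'); first by rewrite /= -szl -ltnS.
  (* The order may use the fused edge in either direction; the path through [v] is followed
     accordingly. *)
  have: ((c, d) \in s) || ((d, c) \in s).
    by rewrite -edge_count_gt0 cnt_s edge_count_gt0 mem_head.
  case/orP=> /splitPr E; case: E cnt_s pl_s => s1 s2 cnt_s pl_s.
    exists (s1 ++ (c, v) :: (v, d) :: s2); last exact: playable_subdivide pl_s.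
    move=> a b; have := cnt_s a b; rewrite !edge_count_cat.
    rewrite !(edge_count_cons a b _ (_ :: _)) !(edge_count_cons a b _ s2).
    rewrite !(edge_count_cons a b _ l) !(edge_count_cons a b _ l') cntl.
    by rewrite cnt1 cnt2; lia.
  exists (s1 ++ (d, v) :: (v, c) :: s2); last exact: playable_subdivide pl_s.
  move=> a b; have := cnt_s a b; rewrite !edge_count_cat.
  rewrite !(edge_count_cons a b _ (_ :: _)) !(edge_count_cons a b _ s2).
  rewrite !(edge_count_cons a b _ l) !(edge_count_cons a b _ l') cntl.
  by rewrite cnt1 cnt2 !(edge_count_flip a b d) (edge_count_flip a b v c); lia.
have [|s cnt_s pl_s] := IH l; first by lia.
exists ((q1, q2) :: s).
  by move=> a b; rewrite edge_count_cons (edge_count_cons _ _ _ l) cnt_s.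
(* An edge meeting no other can be played first: the stocks at the tails of the remaining arcs are
   untouched. *)
rewrite /=; apply: playable_mono pl_s => -[a b] abs /=.
have: ((a, b) \in l) || ((b, a) \in l).
  by rewrite -edge_count_gt0 -cnt_s edge_count_gt0 abs.
by case/orP=> /no_touch; rewrite /touch /= orbF !negb_or;
  move=> /andP[/andP[? ?] /andP[? ?]]; lia.
Qed.

(** * Labelled arc lists and their vertex sums *)

Definition label_sum (T : finType) (L : seq ((T * T) * nat)) (u : T) : int :=
  (\sum_(q <- L) (q.2%:Z *+ (q.1.2 == u) - q.2%:Z *+ (q.1.1 == u)))%R.

Lemma label_sum_cat (T : finType) (L1 L2 : seq ((T * T) * nat)) u :
  label_sum (L1 ++ L2) u = (label_sum L1 u + label_sum L2 u)%R.
Proof. by rewrite /label_sum big_cat. Qed.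

Lemma rev_iotaS m n : rev (iota m n.+1) = m + n :: rev (iota m n).
Proof. by rewrite -addn1 iotaD rev_cat. Qed.

(* Abel summation: the weight of [u] is the sum over thresholds of its token
   balance, which never drops below [- t u]. *)
Lemma playable_label_sum (T : finType) (s : seq (T * T)) (t : T -> nat) u :
  playable t s ->
  (- (t u * size s)%:Z <= label_sum (zip s (rev (iota 1 (size s)))) u)%R.
Proof.
elim: s t => [|q s IH] t; first by rewrite /label_sum big_nil muln0.
rewrite [size _]/= rev_iotaS => /= /andP[t_gt0 /IH].
rewrite /label_sum /= big_cons /= !mulrb !(eq_sym u) /=.
by case: eqP => [<-|_]; case: eqP => [?|_] /=; subst; nia.
Qed.

Lemma edge_list (T : finType) (e : rel T) :
  simple_graph e -> exists l, forall a b, edge_count a b l = e a b :> nat.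
Proof.
case=> esym eirr.
(* Ranks pick one direction of each edge, so each edge is listed once. *)
exists [seq q <- enum {: T * T} | e q.1 q.2 && (enum_rank q.1 < enum_rank q.2)].
move=> a b; rewrite /edge_count count_filter.
pose k (c d : T) := e c d && (enum_rank c < enum_rank d).
have cnt1 c d : count (fun q => (q == (c, d)) && k c d) (enum {: T * T}) = k c d.
  case: (k c d); last first.
    by rewrite (eq_count (a2 := pred0)) ?count_pred0 // => q; rewrite andbF.
  rewrite (eq_count (a2 := pred1 (c, d))) => [|q /=]; last by rewrite andbT.
  by rewrite (count_uniq_mem _ (enum_uniq _)) mem_enum.
have -> : e a b = k a b + k b a :> nat.
  rewrite /k (esym b a); have [ab|] := boolP (e a b); rewrite //=.
  have : enum_rank a != enum_rank b.
    by apply: contraTneq ab => /enum_rank_inj->; rewrite eirr.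
  by rewrite -val_eqE /=; lia.
rewrite -!cnt1 -count_predUI addnC.
rewrite [X in X + _](eq_count (a2 := pred0)); last first.
  move=> [c d]; rewrite /= !xpair_eqE /k.
  by apply/negP => /andP[/andP[_ /andP[_ ?]] /andP[_ /andP[_ ?]]]; lia.
rewrite count_pred0 add0n; apply: eq_count => -[c d] /=.
rewrite !xpair_eqE /k.
by rewrite andb_orl; congr orb; do 2?[case: eqP => //= ->].
Qed.

(** The labels decrease along a playable order that starts with one token everywhere, which gives
    the lower bound. *)
Lemma simple_graph_labelling (T : finType) (e : rel T) :
  simple_graph e ->
  exists L : seq ((T * T) * nat),
    [/\ forall a b, edge_count a b (unzip1 L) = e a b :> nat,
        perm_eq (unzip2 L) (iota 1 (size L))
      & forall u, (- (size L)%:Z <= label_sum L u)%R].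
Proof.
move=> /edge_list[l cnt_l]; have [s cnt_s pl_s] := exists_playable l.
have szi : size (rev (iota 1 (size s))) = size s by rewrite size_rev size_iota.
exists (zip s (rev (iota 1 (size s)))); rewrite size_zip szi minnn.
split=> [a b||u]; rewrite ?unzip1_zip ?unzip2_zip ?szi ?cnt_s //.
  by rewrite perm_rev.
by have := playable_label_sum u pl_s; rewrite mul1n.
Qed.

Lemma uniq_map_inj (A B : eqType) (f : A -> B) (s : seq A) :
  uniq (map f s) -> {in s &, injective f}.
Proof.
elim: s => //= a s IH /andP[fa /IH inj_s] u v; rewrite !inE.
move=> /predU1P[->|us] /predU1P[->|vs] // E; last exact: inj_s.
  by case/negP: fa; rewrite E map_f.
by case/negP: fa; rewrite -E map_f.
Qed.

(** A list counting each edge once repeats no arc and determines an orientation; the label of an arc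
    is read off its only entry. *)
Lemma antimagic_of_labelled_arcs (T : finType) (e : rel T) (L : seq ((T * T) * nat)) :
  simple_graph e ->
  (forall a b, edge_count a b (unzip1 L) = e a b :> nat) ->
  perm_eq (unzip2 L) (iota 1 (size L)) ->
  injective (label_sum L) -> has_antimagic_orientation e.
Proof.
move=> [esym eirr] cntL permL injL.
pose o : rel T := fun a b => (a, b) \in unzip1 L.
pose tau (p : T * T) := \sum_(q <- L | q.1 == p) q.2.
have count_le a b : a != b ->
    count (pred1 (a, b)) (unzip1 L) + count (pred1 (b, a)) (unzip1 L) = e a b.
  move=> ab; rewrite -cntL -count_predUI addnC.
  rewrite -[RHS]add0n -(count_pred0 (unzip1 L)); congr (_ + _).
  apply: eq_count => q /=.
  by case: eqP => //= ->; rewrite xpair_eqE (negPf ab).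
have oe a b : o a b -> e a b.
  have := edge_count_gt0 a b (unzip1 L); rewrite cntL lt0b => -> oab.
  by apply/orP; left.
have uniq1 : uniq (unzip1 L).
  apply: count_mem_uniq => -[a b].
  have [/[dup] abL /oe eab|/count_memPn->//] := boolP ((a, b) \in unzip1 L).
  have ab : a != b by apply: contraTneq eab => ->; rewrite eirr.
  have := count_le a b ab; rewrite eab => cnt.
  have := abL; rewrite -has_pred1 has_count /= => abL'.
  by apply/eqP; rewrite eqn_leq abL' andbT -[1]/(true : nat) -cnt leq_addr.
have uniq2 : uniq (unzip2 L) by rewrite (perm_uniq permL) iota_uniq.
have tauE q : q \in L -> tau q.1 = q.2.
  move=> qL; rewrite /tau big_mkcond (bigD1_seq q) ?(map_uniq uniq1) //= eqxx.
  rewrite big1_seq ?addn0 // => r /andP[rq rL]; case: eqP => // r1.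
  by case/eqP: rq; apply: (uniq_map_inj uniq1).
exists o, tau; split.
- split=> // a b eab.
  have ab : a != b by apply: contraTneq eab => ->; rewrite eirr.
  have := count_le a b ab.
  by rewrite !count_uniq_mem // eab /o; do 2 case: (_ \in _).
- have cardL : #|arcs o| = size L.
    rewrite -(size_map fst) -/(unzip1 L) -(card_uniqP uniq1).
    by apply: eq_card => -[a b]; rewrite inE.
  have arcL p : p \in arcs o -> exists2 q, q \in L & p = q.1.
    by case: p => a b; rewrite inE => /mapP.
  split.
    move=> p p' /arcL[q qL ->] /arcL[q' qL' ->]; rewrite !tauE // => E.
    by rewrite (uniq_map_inj uniq2 qL qL' E).
  move=> p /arcL[q qL ->]; rewrite tauE // cardL.
  have : q.2 \in unzip2 L by apply: map_f.
  by rewrite (perm_mem permL) mem_iota; lia.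
- have tau0 a b : ~~ o a b -> tau (a, b) = 0.
    move=> nab; rewrite /tau big1_seq // => q /andP[/eqP E qL].
    by case/negP: nab; rewrite /o -E map_f.
  suff E u : vsum o tau u = label_sum L u by move=> u v; rewrite !E; apply: injL.
  have tauZ p : ((tau p)%:Z = \sum_(q <- L) q.2%:Z *+ (q.1 == p))%R.
    rewrite /tau (big_morph Posz PoszD (erefl _)) big_mkcond /=.
    by apply: eq_bigr => q _; rewrite mulrb.
  (* [f] sends the other endpoint to its arc at [u], and [E] recognises these arcs. As [tau] is 0
     off the arcs, the sum may run over all [v] before the two sums are exchanged. *)
  have arc_sum (f : T -> T * T) (P : pred T) (E : pred (T * T)) :
      injective f -> (forall v, ~~ P v -> tau (f v) = 0) ->
      (forall p, E p = [exists v, p == f v]) ->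
      (\sum_(v | P v) (tau (f v))%:Z = \sum_(q <- L) q.2%:Z *+ E q.1)%R.
    move=> injf tauP EE; transitivity (\sum_v (tau (f v))%:Z)%R.
      by rewrite big_mkcond; apply: eq_bigr => v _; case: ifPn => // /tauP->.
    rewrite (eq_bigr _ (fun v _ => tauZ (f v))) exchange_big /=.
    apply: eq_bigr => q _; rewrite EE; case: existsP => [[v /eqP->]|nex].
      rewrite (bigD1 v) //= eqxx big1 ?addr0 // => w.
      by rewrite (inj_eq injf) eq_sym => /negPf->.
    by rewrite big1 // => v _; case: eqP => // ?; case: nex; exists v; apply/eqP.
  rewrite /label_sum sumrB /vsum; congr (_ - _)%R.
    apply: (arc_sum (fun v => (v, u)) (o^~ u) (fun p => p.2 == u)) => [v w []|v /tau0|] //.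
    by move=> [a b]; apply/eqP/existsP => [/= ->|[v /eqP[]]//]; exists a.
  apply: (arc_sum (fun v => (u, v)) (o u) (fun p => p.1 == u)) => [v w []|v /tau0|] //.
  by move=> [a b]; apply/eqP/existsP => [/= ->|[v /eqP[]]//]; exists b.
Qed.

(** * Rankings and the separation of vertex sums *)

Definition ranking (T : finType) (V : {set T}) (g : T -> nat) : Prop :=
  {in V &, injective g} /\ (forall v, v \in V -> g v < #|V|).

(** [p] is the partial sum and [g] the rank of the top label received; the offset common to all top
    labels cancels. *)
Definition separates (T : finType) (V : {set T}) (p : T -> int) (g : T -> nat) : Prop :=
  {in V &, injective (fun v => p v + (g v)%:Z)%R}.

Lemma perm_ranking (T : finType) (V : {set T}) g :
  ranking V g -> perm_eq (map g (enum V)) (iota 0 #|V|).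
Proof.
move=> [injg ltg]; have uniqg : uniq (map g (enum V)).
  by rewrite map_inj_in_uniq ?enum_uniq // => u v; rewrite !mem_enum; apply: injg.
apply: uniq_perm; rewrite ?iota_uniq //.
apply: (uniq_min_size uniqg _ _).2; last by rewrite size_map -cardE size_iota.
by move=> i /mapP[v]; rewrite mem_enum mem_iota => /ltg ltv ->.
Qed.

Lemma ranking_onto (T : finType) (V : {set T}) g i :
  ranking V g -> i < #|V| -> exists2 v, v \in V & g v = i.
Proof.
move=> rg lti; have : i \in map g (enum V).
  by rewrite (perm_mem (perm_ranking rg)) mem_iota.
by case/mapP=> v; rewrite mem_enum => vV ->; exists v.
Qed.

Lemma ranking_sum (T : finType) (V : {set T}) f g :
  ranking V f -> ranking V g -> \sum_(v in V) f v = \sum_(v in V) g v.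
Proof.
have sumE k : ranking V k -> \sum_(v in V) k v = \sum_(i <- iota 0 #|V|) i.
  by move=> /perm_ranking pk; rewrite -(perm_big _ pk) big_map big_enum.
by move=> /sumE-> /sumE->.
Qed.

Lemma exists_sorted_ranking (T : finType) (V : {set T}) (p : T -> int) :
  exists2 g, ranking V g & {in V &, forall a b, g a < g b -> (p a <= p b)%R}.
Proof.
pose le_p := relpre p <=%R; pose s := sort le_p (enum V).
have mem_s v : v \in s = (v \in V) by rewrite mem_sort mem_enum.
exists (index^~ s); first split.
- by move=> u v uV vV; apply: (index_inj u); rewrite mem_s.
- by move=> v vV; rewrite cardE -(size_sort le_p) index_mem mem_s.
- move=> a b aV bV; apply: (@sorted_ltn_index _ le_p); rewrite ?mem_s //.
    by move=> u v w; apply: le_trans.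
  by apply: sort_sorted => u v; apply: le_total.
Qed.

Lemma sorted_ranking_separates (T : finType) (V : {set T}) (p : T -> int) f :
  ranking V f -> {in V &, forall a b, f a < f b -> (p a <= p b)%R} ->
  separates V p f.
Proof.
move=> [injf _] monof u v uV vV /= E; apply: injf => //.
by have := monof u v uV vV; have := monof v u vV uV; lia.
Qed.

Lemma exists_separating_ranking (T : finType) (V : {set T}) (p : T -> int) :
  exists2 g, ranking V g & separates V p g.
Proof.
have [f rf monof] := exists_sorted_ranking V p.
by exists f => //; apply: sorted_ranking_separates.
Qed.

(* For a suitable [z], [u] takes the label of [z] and all labels in between drop by
   one; this changes the sum of the colour class [c], as [w] and [u] differ in
   colour.  The minimal [z] above [u] with [p z != p u + 1] creates no coincidence. *)
Lemma shift_rank_or_flat (T : finType) (V : {set T}) (p : T -> int) (c : pred T) f u w :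
  ranking V f -> {in V &, forall a b, f a < f b -> (p a <= p b)%R} ->
  u \in V -> w \in V -> f w = (f u).+1 -> c u != c w ->
  (exists g, [/\ ranking V g, separates V p g
     & \sum_(v in V | c v) g v <> \sum_(v in V | c v) f v]) \/
  {in V, forall t, f u < f t -> p t = (p u + 1)%R}.
Proof.
move=> rf monof uV wV fw cuw; have [injf ltf] := rf.
pose bump z := [&& z \in V, f u < f z & p z != (p u + 1)%R].
case: (pickP bump) => [z0 bump_z0|no_bump]; last first.
  right=> t tV fut; have := no_bump t; rewrite /bump tV fut /=.
  by move/negbT; rewrite negbK => /eqP.
case: (arg_minnP f bump_z0) => z /and3P[zV fuz pz] min_z {z0 bump_z0}.
have flat t : t \in V -> f u < f t < f z -> p t = (p u + 1)%R.
  move=> tV /andP[fut ftz]; apply/eqP; apply: contraLR ftz => pt.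
  by rewrite -leqNgt; apply: min_z; rewrite /bump tV fut.
left; pose g v := if v == u then f z else if f u < f v <= f z then (f v).-1 else f v.
have f_neq a b : a \in V -> b \in V -> a != b -> f a <> f b.
  by move=> aV bV /eqP ab /injf E; apply/ab/E.
have sep a b : a \in V -> b \in V -> f a < f b ->
    (p a + (g a)%:Z <> p b + (g b)%:Z)%R.
  move=> aV bV fab; have pab := monof a b aV bV fab; rewrite /g.
  have [ea|au] := eqVneq a u; have [eb|bu] := eqVneq b u.
  - by move: fab; rewrite ea eb; lia.
  - subst a; rewrite fab /=; have [fbz|] := leqP (f b) (f z); last by lia.
    have [ebz|bz] := eqVneq b z; first by subst b; move/eqP: pz; lia.
    have := f_neq b z bV zV bz; have [fbz' _|] := ltnP (f b) (f z); last by lia.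
    by rewrite (flat b bV) ?fab //; lia.
  - by subst b; case: ifP; lia.
  - have := f_neq a u aV uV au; have := f_neq b u bV uV bu; move: fab pab; clear.
    by case: ifP; case: ifP; lia.
(* A class containing [w] but not [u] strictly loses: only [u] rises in rank, and [w] drops by
   one. *)
have less (d : pred T) : ~~ d u -> d w ->
    \sum_(v in V | d v) g v < \sum_(v in V | d v) f v.
  move=> du dw; rewrite (bigD1 w) ?wV //= [X in _ < X](bigD1 w) ?wV //=.
  rewrite -addSn leq_add //.
    by rewrite /g; case: eqP => [E|_]; [move: du; rewrite -E dw|case: ifP; lia].
  apply: leq_sum => v /andP[/andP[vV dv] _]; rewrite /g.
  by case: eqP => [E|_]; [move: du; rewrite -E dv|clear; case: ifP; lia].
have rg : ranking V g.
  split=> [a b aV bV|v vV]; last first.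
    have := ltf v vV; have := ltf z zV; rewrite /g.
    by case: ifP => _ //; case: ifP; lia.
  rewrite /g; have [->|au] := eqVneq a u; have [->|bu] := eqVneq b u => //.
  - by have := f_neq b u bV uV bu; move: fuz; clear; case: ifP; lia.
  - by have := f_neq a u aV uV au; move: fuz; clear; case: ifP; lia.
  - have := f_neq a u aV uV au; have := f_neq b u bV uV bu => fbu fau E.
    by apply: injf => //; move: fbu fau E; clear; case: ifP; case: ifP; lia.
exists g; split=> //.
  move=> a b aV bV E; apply: injf => //.
  by case: (ltngtP (f a) (f b)) => // fab; [case: (sep a b)|case: (sep b a)].
(* The total is fixed, so if [u] lies in [c], the complement loses and [c] gains. *)
have := ranking_sum rf rg; rewrite (bigID c) /= [X in _ = X](bigID c) /=.
have [cu|ncu] := boolP (c u); last first.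
  by have := less c ncu; move: cuw; rewrite (negPf ncu); case: (c w) => // _ /(_ isT); lia.
have := less (predC c); rewrite /= cu; move: cuw; rewrite cu /= => -> /(_ isT isT); lia.
Qed.

(** Turns a ranking sorted by [p] into one sorted by [- p], so that a shift can also be made in the
    other direction. *)
Lemma rev_ranking (T : finType) (V : {set T}) f :
  ranking V f -> ranking V (fun v => #|V| - (f v).+1).
Proof.
move=> [injf ltf]; split=> [a b aV bV E|v /ltf]; last by lia.
by apply: injf => //; have := ltf a aV; have := ltf b bV; lia.
Qed.

Lemma rev_rank_sum (T : finType) (V : {set T}) (c : pred T) f :
  ranking V f ->
  \sum_(v in V | c v) (#|V| - (f v).+1) + \sum_(v in V | c v) f v
    = \sum_(v in V | c v) #|V|.-1.
Proof.
case=> _ ltf; rewrite -big_split; apply: eq_bigr => v /andP[/ltf] /=; lia.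
Qed.

(** Sort by [p] and take neighbouring ranks of different colours. If no shift is possible in either
    direction, [p] is [p u] up to [u] and [p u + 1] above it, so its sum lies strictly between
    consecutive multiples of [#|V|]. *)
Lemma two_rankings (T : finType) (V : {set T}) (p : T -> int) (c : pred T) a b :
  a \in V -> b \in V -> c a -> ~~ c b -> (\sum_(v in V) p v = 0)%R ->
  exists f g, [/\ ranking V f, ranking V g, separates V p f, separates V p g
    & \sum_(v in V | c v) f v <> \sum_(v in V | c v) g v].
Proof.
move=> aV bV ca cb sum_p; have [f rf monof] := exists_sorted_ranking V p.
have [injf ltf] := rf.
have sepf := sorted_ranking_separates rf monof.
suff [g [rg sepg neq]] : exists g, [/\ ranking V g, separates V p g
     & \sum_(v in V | c v) g v <> \sum_(v in V | c v) f v].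
  by exists f, g; split=> // /esym.
have [u [w [uV wV fw cuw]]] :
    exists u w, [/\ u \in V, w \in V, f w = (f u).+1 & c u != c w].
  (* If neighbouring ranks never changed colour, every vertex would have the colour of the vertex of
     rank 0, against [a] and [b]. *)
  have const i : (forall u w, u \in V -> w \in V -> f w = (f u).+1 -> c u = c w) ->
      forall v0 v, v0 \in V -> v \in V -> f v0 = 0 -> f v = i -> c v = c v0.
    move=> step v0; elim: i => [|i IH] v v0V vV f0 fv.
      by rewrite (injf v v0) // fv f0.
    have [|v' v'V fv'] := ranking_onto (i := i) rf; first by have := ltf v vV; lia.
    by rewrite -(IH v') // (step v' v) // fv fv'.
  have [|v0 v0V f0] := ranking_onto (i := 0) rf; first by apply/card_gt0P; exists a.
  pose bd (q : T * T) := [&& q.1 \in V, q.2 \in V, f q.2 == (f q.1).+1 & c q.1 != c q.2].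
  case: (pickP bd) => [[u w] /and4P[? ? /eqP ? ?]|nobd]; first by exists u, w.
  have step u w : u \in V -> w \in V -> f w = (f u).+1 -> c u = c w.
    move=> uV wV /eqP fw; have := nobd (u, w); rewrite /bd /= uV wV fw /=.
    by move/negbT; rewrite negbK => /eqP.
  have := const _ step v0 a v0V aV f0 erefl; have := const _ step v0 b v0V bV f0 erefl.
  by move: cb; rewrite ca => /negPf-> <-.
have [//|flat_above] := shift_rank_or_flat rf monof uV wV fw cuw.
have mono' : {in V &, forall a b, #|V| - (f a).+1 < #|V| - (f b).+1 -> (- p a <= - p b)%R}.
  by move=> s t sV tV lt_st; rewrite lerN2; apply: monof => //; move: lt_st; clear; lia.
have fw' : #|V| - (f u).+1 = (#|V| - (f w).+1).+1 by have := ltf w wV; lia.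
rewrite eq_sym in cuw.
have [[g [rg sepg neq]]|flat_below] :=
  shift_rank_or_flat (rev_ranking rf) mono' wV uV fw' cuw.
  exists (fun v => #|V| - (g v).+1); split; first exact: rev_ranking.
    move=> s t sV tV E; apply: sepg => //.
    by have := rg.2 s sV; have := rg.2 t tV; move: E; clear; lia.
  by have := rev_rank_sum c rf; have := rev_rank_sum c rg; lia.
(* [flat_above] covers the ranks above [u], and [flat_below], read back from the reversal, those
   below [w]. *)
have pE t : t \in V -> p t = (p u + (f u < f t)%:Z)%R.
  move=> tV; have := flat_above t tV; have := flat_above w wV.
  have := flat_below t tV; have := flat_below u uV; have := ltf t tV; have := ltf w wV.
  have [eq_tu|/eqP] := eqVneq (f t) (f u); first by rewrite (injf t u) // ltnn addr0.
  by move: fw; clear; have [?|?] := ltnP (f u) (f t) => /=; lia.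
move: sum_p; rewrite (eq_bigr _ pE) big_split /= sumr_const.
rewrite -(big_morph Posz PoszD (erefl _)) => sum_p.
(* [w] has the larger value and [u] has not, so the number of vertices with it lies strictly between
   0 and [#|V|]. *)
have n_gt0 : 0 < \sum_(t in V) (f u < f t) by rewrite (bigD1 w) //= fw ltnSn.
have n_lt : \sum_(t in V) (f u < f t) < #|V|.
  rewrite (bigD1 u) //= ltnn add0n (cardD1x uV) add1n ltnS -sum1_card.
  rewrite [X in _ <= X](eq_bigl (fun t => (t \in V) && (t != u))) //.
  by apply: leq_sum => t _; case: (_ < _).
move: sum_p n_gt0 n_lt; rewrite -mulr_natr natz.
move: (\sum_(t in V) _) #|V| (p u); clear=> n k q sum_p n_gt0 n_lt.
by have [q_ge0|q_lt0] := lerP 0%R q; nia.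
Qed.

(** * Three blocks of labels and the arcs from the hubs *)

Lemma edge_countC (T : finType) (a b : T) s : edge_count a b s = edge_count b a s.
Proof. by apply: eq_count => q; rewrite orbC. Qed.

(** Since [h v] lies outside [W], no arc of the star matches both directions, so the two counts
    add. *)
Lemma edge_count_star (T : finType) (W : {set T}) (h : T -> T) a b :
  (forall v, v \in W -> h v \notin W) ->
  edge_count a b [seq (h v, v) | v <- enum W]
    = ((b \in W) && (h b == a)) + ((a \in W) && (h a == b)).
Proof.
move=> hW; rewrite /edge_count count_map.
have cnt1 c d : count (fun v => (h v, v) == (d, c)) (enum W) = (c \in W) && (h c == d).
  rewrite (eq_count (a2 := fun v => (v == c) && (h c == d))) => [|v]; last first.
    by rewrite xpair_eqE andbC; case: eqP => //= ->.
  case: (h c == d); last first.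
    by rewrite andbF (eq_count (a2 := pred0)) ?count_pred0 // => v; rewrite andbF.
  rewrite andbT (eq_count (a2 := pred1 c)) => [|v /=]; last by rewrite andbT.
  by rewrite (count_uniq_mem _ (enum_uniq _)) mem_enum.
rewrite -!cnt1 -count_predUI -[LHS]addn0; congr (_ + _).
rewrite -(count_pred0 (enum W)); apply: eq_in_count => v; rewrite mem_enum => vW /=.
rewrite !xpair_eqE; apply/esym/negP => /andP[/andP[/eqP hv _] /andP[_ /eqP va]].
by move: (hW v vW); rewrite hv -va vW.
Qed.

Definition number_from (T : finType) n (M : seq (T * T)) : seq ((T * T) * nat) :=
  zip M (iota n (size M)).

Lemma unzip1_number_from (T : finType) n (M : seq (T * T)) :
  unzip1 (number_from n M) = M.
Proof. by rewrite unzip1_zip ?size_iota. Qed.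

Lemma unzip2_number_from (T : finType) n (M : seq (T * T)) :
  unzip2 (number_from n M) = iota n (size M).
Proof. by rewrite unzip2_zip ?size_iota. Qed.

Lemma number_from_cat (T : finType) n (M1 M2 : seq (T * T)) :
  number_from n (M1 ++ M2) = number_from n M1 ++ number_from (n + size M1) M2.
Proof. by rewrite /number_from size_cat iotaD zip_cat ?size_iota. Qed.

Lemma label_sum_cons (T : finType) q (L : seq ((T * T) * nat)) u :
  label_sum (q :: L) u
    = (q.2%:Z *+ (q.1.2 == u) - q.2%:Z *+ (q.1.1 == u) + label_sum L u)%R.
Proof. by rewrite /label_sum big_cons. Qed.

Lemma label_sum_nil (T : finType) (u : T) : label_sum [::] u = 0%R.
Proof. by rewrite /label_sum big_nil. Qed.

(** The arc from the hub [h v] to [v] carries the top label [N + g v]; this is what the hub [u] pays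
    out. *)
Definition hub_load (T : finType) (V : {set T}) (h : T -> T) N (g : T -> nat) u : nat :=
  \sum_(v in V | h v == u) (N + g v).

Lemma label_sum_star (T : finType) (V : {set T}) h N g u :
  (forall v, v \in V -> h v \notin V) ->
  label_sum [seq ((h v, v), N + g v) | v <- enum V] u
    = (if u \in V then (N + g u)%N%:Z else - (hub_load V h N g u)%:Z)%R.
Proof.
move=> hV; rewrite /label_sum big_map big_enum sumrB /=.
rewrite /hub_load (big_morph Posz PoszD (erefl _)) big_mkcondr /=.
under [X in (_ - X)%R]eq_bigr => v _ do rewrite mulrb.
under eq_bigr => v _ do rewrite mulrb.
case: ifPn => uV.
  rewrite (bigD1 u) //= eqxx big1 ?addr0 => [|v /andP[_ /negPf->]//].
  rewrite big1 ?subr0 // => v vV; case: eqP => // hv.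
  by have := hV v vV; rewrite hv uV.
rewrite big1 ?sub0r // => v vV; case: eqP => // vu.
by move: uV; rewrite -vu vV.
Qed.

Definition inner_labelling (T : finType) (e : rel T) (V : {set T}) L0 : Prop :=
  [/\ forall a b, edge_count a b (unzip1 L0) = [&& a \in V, b \in V & e a b] :> nat,
      perm_eq (unzip2 L0) (iota 1 (size L0))
    & forall u, (- (size L0)%:Z <= label_sum L0 u)%R].

Lemma exists_inner_labelling (T : finType) (e : rel T) (V : {set T}) :
  simple_graph e -> exists L0, inner_labelling e V L0.
Proof.
case=> esym eirr.
apply: (@simple_graph_labelling _ (fun a b => [&& a \in V, b \in V & e a b])).
by split=> [a b|a]; rewrite ?eirr ?andbF // esym andbCA.
Qed.

Lemma label_sum_outside (T : finType) (e : rel T) (V : {set T}) L0 u :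
  inner_labelling e V L0 -> u \notin V -> label_sum L0 u = 0%R.
Proof.
case=> cnt0 _ _ uV; rewrite /label_sum big1_seq // => -[[a b] n] /andP[_ qL] /=.
have := edge_count_gt0 a b (unzip1 L0).
rewrite cnt0 lt0b (map_f fst qL) => /and3P[aV bV _].
have [E|_] := eqVneq b u; first by rewrite -E bV in uV.
by have [E|_] := eqVneq a u; [rewrite -E aV in uV|rewrite subrr].
Qed.

(** The final sum outside [V]: inner arcs do not reach it, the arcs of [M] carry the labels just
    above [m], and the arcs into [V] from their hubs those from [m + size M + 1] on. *)
Definition outside_sum (T : finType) (V : {set T}) (h : T -> T) m M
    (g : T -> nat) u : int :=
  (label_sum (number_from m.+1 M) u - (hub_load V h (m + size M).+1 g u)%:Z)%R.

(** Labels go to the inner arcs, then to [M], then to the arcs from [h v] to [v]. At a vertex of [V]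
    the inner arcs give at least [-m], arcs of [M] only enter, and the top label exceeds [m]; the
    positive total cannot equal a sum outside [V]. *)
Lemma antimagic_of_hubs (T : finType) (e : rel T) (V : {set T}) h M L0 g :
  simple_graph e ->
  inner_labelling e V L0 ->
  (forall v, v \in V -> h v \notin V) ->
  (forall q, q \in M -> q.1 \notin V) ->
  (forall a b, a \notin V ->
     edge_count a b M + ((b \in V) && (h b == a)) = e a b :> nat) ->
  ranking V g ->
  separates V (label_sum (L0 ++ number_from (size L0).+1 M)) g ->
  (forall u, u \notin V -> (outside_sum V h (size L0) M g u <= 0)%R) ->
  {in [predC V] &, injective (outside_sum V h (size L0) M g)} ->
  has_antimagic_orientation e.
Proof.
move=> eP L0P hV tailM hM rg sepg le0 inj0; have [cnt0 perm0 bound0] := L0P.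
set m := size L0 in sepg le0 inj0 *; pose N := (m + size M).+1.
pose L := (L0 ++ number_from m.+1 M) ++ [seq ((h v, v), N + g v) | v <- enum V].
have [esym eirr] := eP.
have mid_ge0 v : v \in V -> (0 <= label_sum (number_from m.+1 M) v)%R.
  move=> vV; rewrite /label_sum big_seq sumr_ge0 // => q qM.
  have : q.1 \in M by rewrite -(unzip1_number_from m.+1 M) map_f.
  by move=> /tailM; have [->|_] := eqVneq q.1.1 v; rewrite ?vV //; lia.
have LE u : label_sum L u =
    if u \in V then (label_sum (L0 ++ number_from m.+1 M) u + N%:Z + (g u)%:Z)%R
    else outside_sum V h m M g u.
  rewrite label_sum_cat label_sum_star //; case: ifPn => uV; first by rewrite PoszD addrA.
  by rewrite label_sum_cat (label_sum_outside L0P) // add0r.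
have L_gt0 u : u \in V -> (0 < label_sum L u)%R.
  move=> uV; rewrite LE uV label_sum_cat.
  by have := mid_ge0 u uV; have := bound0 u; rewrite /N -/m; lia.
have L_le0 u : u \notin V -> (label_sum L u <= 0)%R by move=> uV; rewrite LE (negPf uV) le0.
apply: (@antimagic_of_labelled_arcs _ _ L) => //.
- move=> a b; rewrite /L {1}/unzip1 !map_cat -/(unzip1 L0).
  rewrite -/(unzip1 (number_from _ _)) unzip1_number_from -map_comp.
  rewrite !edge_count_cat cnt0 edge_count_star //.
  have [aV|aV] := boolP (a \in V); have [bV|bV] := boolP (b \in V) => /=.
  + rewrite (_ : edge_count a b M = 0); last first.
      apply/eqP; rewrite -leqn0 leqNgt edge_count_gt0.
      by apply/negP => /orP[] /tailM; rewrite ?aV ?bV.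
    have := hV a aV; have := hV b bV.
    have [->|_] := eqVneq (h b) a; first by rewrite aV.
    by have [->|_] := eqVneq (h a) b; [rewrite bV|rewrite !addn0].
  + by have := hM b a bV; rewrite aV edge_countC (esym b a) => <- /=; rewrite add0n.
  + by have := hM a b aV; rewrite bV => <-; rewrite !add0n addn0.
  + by have := hM a b aV; rewrite (negPf bV) => <-; rewrite !addn0.
- rewrite /L {1}/unzip2 !map_cat -/(unzip2 L0).
  rewrite -/(unzip2 (number_from _ _)) unzip2_number_from -map_comp.
  rewrite !size_cat size_map -cardE size_zip size_iota minnn -/m !iotaD.
  rewrite -!catA; apply: perm_cat => //; rewrite add1n perm_cat2l.
  have -> : iota (m.+1 + size M) #|V| = map (addn N) (iota 0 #|V|).
    by rewrite -iotaDl addn0.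
  by rewrite (map_comp (addn N) g) perm_map // perm_ranking.
- move=> u v; have [uV|uV] := boolP (u \in V); have [vV|vV] := boolP (v \in V).
  + by rewrite !LE uV vV !(addrAC _ N%:Z)%R => /addIr; apply: sepg.
  + by have := L_gt0 u uV; have := L_le0 v vV; lia.
  + by have := L_gt0 v vV; have := L_le0 u uV; lia.
  + by rewrite !LE (negPf uV) (negPf vV) => /inj0; apply; rewrite inE.
Qed.

(** * The configurations of the hubs *)

Lemma label_sum_total (T : finType) (L : seq ((T * T) * nat)) :
  (\sum_u label_sum L u = 0)%R.
Proof.
rewrite /label_sum exchange_big big1 //= => q _; rewrite sumrB.
have one w : (\sum_u q.2%:Z *+ (w == u) = q.2%:Z :> int)%R.
  by rewrite (bigD1 w) //= eqxx big1 ?addr0 // => v; rewrite eq_sym => /negPf->.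
by rewrite !one subrr.
Qed.

Lemma separates_ext (T : finType) (V : {set T}) (p p' : T -> int) g :
  {in V, p =1 p'} -> separates V p g -> separates V p' g.
Proof. by move=> pp' sep u v uV vV /=; rewrite -!pp' //; apply: sep. Qed.

(** The hub is the only vertex outside [V], so any separating ranking will do, with an empty [M]. *)
Lemma antimagic_of_one_hub (T : finType) (e : rel T) x :
  simple_graph e -> (forall v, v != x -> e x v) -> has_antimagic_orientation e.
Proof.
move=> eP dom; pose V := [set~ x].
have [L0 L0P] := exists_inner_labelling V eP.
have [g rg sepg] :=
  exists_separating_ranking V (label_sum (L0 ++ number_from (size L0).+1 [::])).
have notV u : u \notin V -> u = x by rewrite !inE negbK => /eqP.
apply: (antimagic_of_hubs (h := fun=> x) (M := [::]) eP L0P _ _ _ rg sepg).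
- by move=> v _; rewrite !inE eqxx.
- by [].
- move=> a b /notV->; rewrite !inE eqxx andbT /edge_count /= add0n.
  by have [->|/dom->//] := eqVneq b x; rewrite (eP.2 x).
- by move=> u _; rewrite /outside_sum /number_from label_sum_nil; lia.
- by move=> u v /notV-> /notV->.
Qed.

Lemma antimagic_of_two_hubs (T : finType) (e : rel T) x y h M L0 g
    (V := ~: [set x; y]) :
  simple_graph e -> inner_labelling e V L0 ->
  (forall v, (h v == x) || (h v == y)) ->
  (forall q, q \in M -> (q.1 == x) || (q.1 == y)) ->
  (forall b, edge_count x b M + ((b \in V) && (h b == x)) = e x b :> nat) ->
  (forall b, edge_count y b M + ((b \in V) && (h b == y)) = e y b :> nat) ->
  ranking V g ->
  separates V (label_sum (L0 ++ number_from (size L0).+1 M)) g ->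
  (outside_sum V h (size L0) M g x <= 0)%R ->
  (outside_sum V h (size L0) M g y <= 0)%R ->
  outside_sum V h (size L0) M g x != outside_sum V h (size L0) M g y ->
  has_antimagic_orientation e.
Proof.
move=> eP L0P hxy Mxy countx county rg sepg lex ley neq.
have notV u : u \notin V -> u = x \/ u = y.
  by rewrite !inE negbK => /orP[]/eqP; [left|right].
apply: (antimagic_of_hubs (h := h) (M := M) eP L0P _ _ _ rg sepg).
- by move=> v _; rewrite !inE negbK.
- by move=> q /Mxy; rewrite !inE negbK.
- by move=> a b /notV[]->.
- by move=> u /notV[]->.
- move=> u v /notV[]-> /notV[]-> // E; first by rewrite E eqxx in neq.
  by rewrite E eqxx in neq.
Qed.

Lemma hub_load_ge (T : finType) (V : {set T}) h N g u v :
  v \in V -> h v = u -> N <= hub_load V h N g u.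
Proof.
move=> vV hv; rewrite /hub_load (bigD1 v) ?vV ?hv ?eqxx //=.
by rewrite -addnA leq_addr.
Qed.

(** The middle block consists of the edge [xy] if present, one hub edge of [z], and the edges from
    [y] to the other common neighbours; every non-hub still gets a top arc. *)
Lemma antimagic_common_neighbour (T : finType) (e : rel T) x y z :
  simple_graph e -> x != y -> (forall v, [|| v == x, v == y, e x v | e y v]) ->
  e x z -> e y z -> has_antimagic_orientation e.
Proof.
move=> eP xy dom xz yz; have [esym eirr] := eP.
pose V := ~: [set x; y]; have [L0 L0P] := exists_inner_labelling V eP.
have xV : x \notin V by rewrite !inE eqxx.
have yV : y \notin V by rewrite !inE eqxx orbT.
have zx : z != x by apply: contraTneq xz => ->; rewrite eirr.
have zy : z != y by apply: contraTneq yz => ->; rewrite eirr.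
have zV : z \in V by rewrite !inE negb_or zx.
pose C := [set v in V | [&& v != z, e x v & e y v]].
pose R := [seq (y, v) | v <- enum C].
pose q := if e x y then [:: (y, x)] else [::].
pose M w := q ++ (w, z) :: R.
(* Exchanging the labels of [xz] and [yz] moves the sums of [x] and [y] apart
   and changes no other sum; [t] records which of the two is the top one. *)
pose h (t : bool) v := if v == z then if t then x else y else if e x v then x else y.
pose w (t : bool) := if t then y else x.
pose m := size L0; pose lz := (m.+1 + size q)%N; pose N := (m + size (M x)).+1.
have sizeM t : size (M (w t)) = size (M x) by rewrite /M !size_cat.
pose S v := label_sum (number_from lz.+1 R) v.
have midE t v : label_sum (number_from m.+1 (M (w t))) v =
    (label_sum (number_from m.+1 q) v + lz%:Z *+ (z == v) - lz%:Z *+ (w t == v) + S v)%R.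
  rewrite /M number_from_cat label_sum_cat /number_from /= label_sum_cons /=.
  by rewrite -/lz !addrA.
have [g rg sepg] := exists_separating_ranking V
  (label_sum (L0 ++ number_from m.+1 (M (w true)))).
(* The two choices differ only in the tail of one middle arc, which is a hub, so one ranking serves
   both. *)
have sepgt t : separates V (label_sum (L0 ++ number_from m.+1 (M (w t)))) g.
  apply: separates_ext sepg => v vV; rewrite !label_sum_cat !midE.
  have ne t' : (w t' == v) = false.
    by apply/negbTE; apply: contraTneq vV => <-; case: t'.
  by rewrite !ne.
have Rneg u : u \notin V -> (S u <= 0)%R.
  move=> uV; rewrite /S /label_sum big_seq sumr_le0 // => p pR.
  have : p.1 \in R by rewrite -(unzip1_number_from lz.+1 R) map_f.
  case/mapP=> v; rewrite mem_enum inE => /andP[vV _] -> /=.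
  have [E|_] := eqVneq v u; first by rewrite -E vV in uV.
  by rewrite sub0r oppr_le0 mulrn_wge0.
have Rx : S x = 0%R.
  rewrite /S /label_sum big1_seq // => p /andP[_ pR].
  have : p.1 \in R by rewrite -(unzip1_number_from lz.+1 R) map_f.
  case/mapP=> v; rewrite mem_enum inE => /andP[vV _] -> /=.
  rewrite eq_sym in xy; rewrite (negPf xy) subr0.
  by have [E|//] := eqVneq v x; rewrite -E vV in xV.
(* The label of the arc from [y] to [x], first in the middle block, or 0 if there is none. *)
pose l := if e x y then m.+1 else 0.
have qx : label_sum (number_from m.+1 q) x = l%:Z%R.
  rewrite /q /l; case: (e x y); rewrite ?label_sum_nil // label_sum_cons /= label_sum_nil.
  by rewrite eqxx (eq_sym y) (negPf xy) subr0 addr0.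
have qy : label_sum (number_from m.+1 q) y = (- l%:Z)%R.
  rewrite /q /l; case: (e x y); rewrite ?label_sum_nil // label_sum_cons /= label_sum_nil.
  by rewrite eqxx (negPf xy) sub0r addr0.
(* The only arc entering [x] thus carries less than the arc from [x] to [z], whether the latter has
   label [lz] or [N + g z]. *)
have l_lt : l < lz by rewrite /l /lz /q; case: (e x y) => /=; lia.
have lz_lt : lz < N + g z by rewrite /lz /N /M size_cat /=; lia.
pose X := \sum_(v in V | (v != z) && e x v) (N + g v).
pose Y := \sum_(v in V | (v != z) && ~~ e x v) (N + g v).
have loadE t u : hub_load V (h t) N g u =
    (if h t z == u then N + g z else 0) +
    \sum_(v in V | (v != z) && (h t v == u)) (N + g v).
  rewrite /hub_load; case: ifPn => hz.
    rewrite (bigD1 z) ?zV //=; congr addn.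
    by apply: eq_bigl => v; rewrite andbAC andbA.
  rewrite add0n; apply: eq_bigl => v; have [->|_] //= := eqVneq v z.
  by rewrite (negPf hz) andbF.
have hz t : h t z = if t then x else y by rewrite /h eqxx.
have yx : (y == x) = false by rewrite eq_sym (negPf xy).
have loadx t : hub_load V (h t) N g x = (if t then N + g z else 0) + X.
  rewrite loadE hz; congr addn; first by case: t; rewrite ?eqxx ?yx.
  apply: eq_bigl => v; rewrite /h; have [_|_] //= := eqVneq v z.
  by case: (e x v); rewrite ?eqxx ?yx.
have loady t : hub_load V (h t) N g y = (if t then 0 else N + g z) + Y.
  rewrite loadE hz; congr addn; first by case: t; rewrite ?eqxx ?(negPf xy).
  apply: eq_bigl => v; rewrite /h; have [_|_] //= := eqVneq v z.
  by case: (e x v); rewrite ?eqxx ?(negPf xy).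
have outx t : outside_sum V (h t) m (M (w t)) g x
    = (l%:Z - (if t then N + g z else lz)%N%:Z - X%:Z)%R.
  rewrite /outside_sum sizeM -/N loadx midE qx Rx (negPf zx) /w.
  by case: t; rewrite ?eqxx ?yx /=; clear; lia.
have outy t : outside_sum V (h t) m (M (w t)) g y
    = (S y - l%:Z - (if t then lz else N + g z)%N%:Z - Y%:Z)%R.
  rewrite /outside_sum sizeM -/N loady midE qy (negPf zy) /w.
  by case: t; rewrite ?eqxx ?(negPf xy) /=; clear; lia.
have Sy := Rneg y yV.
(* The two choices change the difference of the hub sums by twice [N + g z - lz], which is
   positive. *)
have [t neq] : exists t, outside_sum V (h t) m (M (w t)) g x
    != outside_sum V (h t) m (M (w t)) g y.
  have [|] := boolP (outside_sum V (h true) m (M (w true)) g x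
    != outside_sum V (h true) m (M (w true)) g y); first by exists true.
  rewrite negbK => /eqP; rewrite outx outy => E; exists false; apply/eqP.
  by rewrite outx outy; move: E lz_lt; clear; lia.
have countR a b : edge_count a b R = ((b \in C) && (y == a)) + ((a \in C) && (y == b)).
  apply: (edge_count_star (h := fun=> y)) => v _.
  by rewrite inE (negPf yV).
have countM b u : edge_count u b (M (w t)) =
    edge_count u b q + edge_count u b [:: (w t, z)] + edge_count u b R.
  by rewrite /M edge_count_cat edge_count_cons addnA.
have ne := ((negPf xy), yx, (negPf zx), (negPf zy), (eq_sym x z), (eq_sym y z),
  eqxx, eirr, orbT, orbF, andbT, andbF).
have arcs_at u : u \in [:: x; y] -> forall b,
    edge_count u b (M (w t)) + ((b \in V) && (h t b == u)) = e u b :> nat.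
  rewrite !inE => uxy b; rewrite countM countR !inE /edge_count /q /h /w {countM neq}.
  have [->|bx] := eqVneq b x.
    by case/orP: uxy => /eqP->; rewrite ?(esym y x); case: (e x y); case: t;
      rewrite /= ?xpair_eqE ?ne.
  have [->|by_] := eqVneq b y.
    by case/orP: uxy => /eqP->; case: (e x y); case: t; rewrite /= ?xpair_eqE ?ne.
  have [->|bz] := eqVneq b z.
    by case/orP: uxy => /eqP->; rewrite ?xz ?yz; case: (e x y); case: t;
      rewrite /= ?xpair_eqE ?ne.
  have [xb yb zb] : [/\ (x == b) = false, (y == b) = false & (z == b) = false].
    by rewrite !(eq_sym _ b) (negPf bx) (negPf by_) (negPf bz).
  have neb := (negPf bx, negPf by_, negPf bz, xb, yb, zb).
  have := dom b; rewrite !neb /=.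
  by case/orP: uxy => /eqP->; case: (e x b); case: (e y b); case: (e x y); case: t;
    rewrite /= ?xpair_eqE ?ne ?neb.
apply: (antimagic_of_two_hubs (h := h t) (M := M (w t)) eP L0P
  _ _ _ _ rg (sepgt t) _ _ neq).
- move=> v; rewrite /h.
  by case: t {neq countM arcs_at}; case: (v == z); case: (e x v); rewrite eqxx ?orbT.
- move=> p; rewrite mem_cat inE => /or3P[|/eqP->|/mapP[v _ ->]] /=.
  + by rewrite /q; case: ifP => // _; rewrite inE => /eqP->; rewrite eqxx orbT.
  + by rewrite /w; case: t {neq countM arcs_at} => /=; rewrite eqxx ?orbT.
  + by rewrite eqxx orbT.
- by apply: arcs_at; rewrite !inE eqxx.
- by apply: arcs_at; rewrite !inE eqxx orbT.
- by rewrite outx; move: l_lt lz_lt; clear; case: t; lia.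
- by rewrite outy; move: Sy; clear; case: t; lia.
Qed.

Lemma antimagic_adjacent (T : finType) (e : rel T) x y a b :
  simple_graph e -> x != y -> (forall v, [|| v == x, v == y, e x v | e y v]) ->
  (forall v, ~~ (e x v && e y v)) -> e x y ->
  a != y -> e x a -> b != x -> e y b -> has_antimagic_orientation e.
Proof.
move=> eP xy dom disj exy ay xa bx yb; have [esym eirr] := eP.
pose V := ~: [set x; y]; have [L0 L0P] := exists_inner_labelling V eP.
have ax : a != x by apply: contraTneq xa => ->; rewrite eirr.
have by_ : b != y by apply: contraTneq yb => ->; rewrite eirr.
have aV : a \in V by rewrite !inE negb_or ax.
have bV : b \in V by rewrite !inE negb_or bx.
have yx : (y == x) = false by rewrite eq_sym (negPf xy).
pose h v := if e x v then x else y.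
pose M (t : bool) := [:: if t then (x, y) else (y, x)].
pose m := size L0; pose N := (m + 1).+1.
have midE t v : label_sum (number_from m.+1 (M t)) v =
    (if t then m.+1%:Z *+ (y == v) - m.+1%:Z *+ (x == v)
     else m.+1%:Z *+ (x == v) - m.+1%:Z *+ (y == v))%R.
  by rewrite label_sum_cons label_sum_nil addr0; case: t.
have [g rg sepg] := exists_separating_ranking V
  (label_sum (L0 ++ number_from m.+1 (M true))).
have sepgt t : separates V (label_sum (L0 ++ number_from m.+1 (M t))) g.
  apply: separates_ext sepg => v; rewrite !inE negb_or => /andP[vx vy].
  by rewrite !label_sum_cat !midE !(eq_sym _ v) (negPf vx) (negPf vy); case: t.
have loadx : N <= hub_load V h N g x by apply: hub_load_ge aV _; rewrite /h xa.
have loady : N <= hub_load V h N g y.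
  by apply: hub_load_ge bV _; rewrite /h; have := disj b; rewrite yb andbT => /negPf->.
have outE t u : outside_sum V h m (M t) g u
    = (label_sum (number_from m.+1 (M t)) u - (hub_load V h N g u)%:Z)%R by [].
have [t neq] : exists t, outside_sum V h m (M t) g x != outside_sum V h m (M t) g y.
  have [|] := boolP (outside_sum V h m (M true) g x != outside_sum V h m (M true) g y).
    by exists true.
  rewrite negbK => /eqP E; exists false; apply/eqP; move: E.
  by rewrite !outE !midE !eqxx yx (negPf xy) /=; clear; lia.
have ne := (negPf xy, yx, eqxx, eirr, orbT, orbF, andbT, andbF).
have arcs_at u : u \in [:: x; y] -> forall c,
    edge_count u c (M t) + ((c \in V) && (h c == u)) = e u c :> nat.
  rewrite !inE => uxy c; rewrite /edge_count /h !inE {neq}.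
  have [->|cx] := eqVneq c x.
    by case/orP: uxy => /eqP->; rewrite ?(esym y x); case: t;
      rewrite /= ?xpair_eqE ?ne ?exy.
  have [->|cy] := eqVneq c y.
    by case/orP: uxy => /eqP->; case: t; rewrite /= ?xpair_eqE ?ne ?exy.
  have [xc yc] : (x == c) = false /\ (y == c) = false.
    by rewrite !(eq_sym _ c) (negPf cx) (negPf cy).
  have nec := (negPf cx, negPf cy, xc, yc).
  have := disj c; have := dom c; rewrite !nec /=.
  by case/orP: uxy => /eqP->; case: (e x c); case: (e y c); case: t;
    rewrite /= ?xpair_eqE ?ne ?nec.
apply: (antimagic_of_two_hubs (h := h) (M := M t) eP L0P _ _ _ _ rg (sepgt t) _ _ neq).
- by move=> v; rewrite /h; case: (e x v); rewrite eqxx ?orbT.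
- by move=> p; rewrite inE => /eqP->; case: t {neq arcs_at}; rewrite eqxx ?orbT.
- by apply: arcs_at; rewrite !inE eqxx.
- by apply: arcs_at; rewrite !inE eqxx orbT.
- by rewrite outE midE !ne; move: loadx; clear; case: t; lia.
- by rewrite outE midE !ne; move: loady; clear; case: t; lia.
Qed.

(** With an empty middle block the hub sums are minus the loads. The total load does not depend on
    the ranking, so two rankings with different loads at [x] cannot both make the hubs equal. *)
Lemma antimagic_no_common_neighbour (T : finType) (e : rel T) x y a :
  simple_graph e -> x != y -> (forall v, [|| v == x, v == y, e x v | e y v]) ->
  (forall v, ~~ (e x v && e y v)) -> ~~ e x y ->
  e x a -> has_antimagic_orientation e.
Proof.
move=> eP xy dom disj exy xa; have [esym eirr] := eP.
pose V := ~: [set x; y]; have [L0 L0P] := exists_inner_labelling V eP.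
have ax : a != x by apply: contraTneq xa => ->; rewrite eirr.
have ay : a != y by apply: contraTneq xa => ->.
have aV : a \in V by rewrite !inE negb_or ax.
have yx : (y == x) = false by rewrite eq_sym (negPf xy).
pose h v := if e x v then x else y.
have hx v : (h v == x) = e x v by rewrite /h; case: ifP; rewrite ?eqxx ?yx.
have hy v : (h v == y) = ~~ e x v by rewrite /h; case: ifP; rewrite ?eqxx ?(negPf xy).
pose m := size L0; pose N := (m + 0).+1.
have outE g u : outside_sum V h m [::] g u = (- (hub_load V h N g u)%:Z)%R.
  by rewrite /outside_sum label_sum_nil sub0r.
suff [g [rg sepg neq]] : exists g, [/\ ranking V g, separates V (label_sum L0) g
    & hub_load V h N g x <> hub_load V h N g y].
  apply: (antimagic_of_two_hubs (h := h) (M := [::]) (g := g) eP L0P) => //.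
  - by move=> v; rewrite hx hy; case: (e x v).
  - move=> b; rewrite hx !inE /edge_count /= add0n.
    have [->|bx] := eqVneq b x; first by rewrite eirr.
    by have [->|_] := eqVneq b y; first by rewrite (negPf exy).
  - move=> b; rewrite hy !inE /edge_count /= add0n.
    have [->|bx] := eqVneq b x; first by rewrite esym (negPf exy).
    have [->|by_] := eqVneq b y; first by rewrite eirr.
    have := dom b; have := disj b; rewrite (negPf bx) (negPf by_) /=.
    by case: (e x b); case: (e y b).
  - by rewrite cats0.
  - by rewrite outE; lia.
  - by rewrite outE; lia.
  - by rewrite !outE; apply/eqP; lia.
have [b /andP[bV yb]|noB] := pickP (fun v => (v \in V) && ~~ e x v); last first.
  (* All of [V] hangs on [x]: the load of [y] is 0, that of [x] at least [N]. *)
  have [g rg sepg] := exists_separating_ranking V (label_sum L0).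
  exists g; split=> //; have := hub_load_ge N g aV (eqP (etrans (hx a) xa)).
  rewrite [X in _ <> X]/hub_load big1 => [|v /andP[vV]]; first by rewrite /N; lia.
  by have := noB v; rewrite vV hy /= => ->.
(* Every label is added once and subtracted once, and the inner arcs contribute nothing outside
   [V]. *)
have sum0 : (\sum_(v in V) label_sum L0 v = 0)%R.
  have := label_sum_total L0; rewrite (bigID (mem V)) /=.
  by rewrite [X in (_ + X)%R]big1 ?addr0 // => v; apply: label_sum_outside L0P.
have [f1 [f2 [r1 r2 s1 s2 neq]]] := two_rankings (c := e x) aV bV xa yb sum0.
have loadE f u : hub_load V h N f u
    = \sum_(v in V | h v == u) N + \sum_(v in V | h v == u) f v.
  by rewrite /hub_load big_split.
have total f : hub_load V h N f x + hub_load V h N f y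
    = \sum_(v in V) N + \sum_(v in V) f v.
  rewrite -big_split /= [RHS](bigID (e x)) /hub_load /=; congr addn; apply: eq_bigl => v.
    by rewrite hx.
  by rewrite hy.
have loadx f : hub_load V h N f x = \sum_(v in V | h v == x) N + \sum_(v in V | e x v) f v.
  by rewrite loadE; congr addn; apply: eq_bigl => v; rewrite hx.
have [E1|] := eqVneq (hub_load V h N f1 x) (hub_load V h N f1 y); last first.
  by move/eqP; exists f1.
exists f2; split=> // E2.
have := total f1; have := total f2; rewrite (ranking_sum r1 r2) -E1 -E2.
by have := loadx f1; have := loadx f2; lia.
Qed.

Theorem theorem2p3 (T : finType) (e : rel T) (x y : T) :
  simple_graph e ->
  x != y ->
  cnbhd e x :|: cnbhd e y = [set: T] ->
  (deg e y <= deg e x)%N ->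
  ((4 <= deg e x)%N \/ nbhd e x :&: cnbhd e y != set0) ->
  has_antimagic_orientation e.
Proof.
move=> eP xy cover deg_yx near; have [esym eirr] := eP.
have dom v : [|| v == x, v == y, e x v | e y v].
  have : v \in cnbhd e x :|: cnbhd e y by rewrite cover inE.
  by rewrite !inE => /orP[]/orP[]->; rewrite ?orbT.
have [z /andP[xz yz]|disj] := pickP (fun v => e x v && e y v).
  exact: (antimagic_common_neighbour eP xy dom xz yz).
have {}disj v : ~~ (e x v && e y v) by rewrite disj.
have [exy|nexy] := boolP (e x y); last first.
  have [a xa] : exists a, e x a.
    case: near => [deg4|/set0Pn[a]]; last by rewrite !inE => /andP[xa _]; exists a.
    have /card_gt0P[a] : 0 < #|nbhd e x| by apply: leq_trans deg4.
    by rewrite inE; exists a.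
  exact: (antimagic_no_common_neighbour eP xy dom disj nexy xa).
have [b /andP[bx nxb]|domx] := pickP (fun v => (v != x) && ~~ e x v); last first.
  apply: (antimagic_of_one_hub (x := x) eP) => v vx; have := domx v; rewrite /= vx /=.
  by move/negbT; rewrite negbK.
have yb : e y b.
  have := dom b; rewrite (negPf bx) (negPf nxb) /= => /orP[/eqP E|//].
  by rewrite E exy in nxb.
(* [y] has the two neighbours [x] and [b], so by the degree condition [x] has a neighbour besides
   [y]. *)
have : 1 < #|nbhd e x|.
  apply: leq_trans deg_yx; rewrite /deg (cardsD1 x) inE (esym y x) exy (cardsD1 b).
  by rewrite !inE bx yb.
rewrite (cardsD1 y) inE exy ltnS => /card_gt0P[a]; rewrite !inE => /andP[ay xa].
exact: (antimagic_adjacent eP xy dom disj exy ay xa bx yb).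
Qed.
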